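(* Let $n,k,N\ge 1$ be integers, and let $A_\nu\in M_n$ and $B_\nu\in M_k$, $\nu=1,\ldots,N$, be diagonal matrices. If $X\in M_{nk}\equiv M_n\otimes M_k$, $X\geq 0$, satisfies $$\operatorname{tr}\big[(A_\nu\otimes E^{(k)}_{ml})X\big]=B_{\nu,lm}\qquad\text{for all }\nu=1,\ldots,N\text{ and }l,m=1,\ldots,k,$$ then $\widetilde{X}$ also is a solution to these equations, namely $$\operatorname{tr}\big[(A_\nu\otimes E^{(k)}_{ml})\widetilde{X}\big]=B_{\nu,lm}\qquad\text{for all }\nu=1,\ldots,N\text{ and }l,m=1,\ldots,k.$$
   Context: $M_n$ denotes the algebra of all $n\times n$ complex matrices, $\operatorname{tr}$ the (unnormalized) trace, and $X\geq 0$ means that $X$ is positive semidefinite. $E^{(k)}_{ml}\in M_k$ is the matrix unit with entry $1$ in position $(m,l)$ and $0$ elsewhere, and $B_{\nu,lm}$ is the $(l,m)$ entry of $B_\nu$. The identification $M_{nk}\equiv M_n\otimes M_k$ is the standard one (Kronecker product): rows and columns of matrices in $M_{nk}$ are indexed by pairs $(i,m)\in\{1,\ldots,n\}\times\{1,\ldots,k\}$ ordered lexicographically, and $(u\otimes v)_{(i,m),(j,l)}=u_{ij}v_{ml}$. For a square matrix $u=[u_{ij}]_{i,j}$, $\widetilde{u}=[u_{ij}\delta_{ij}]_{i,j}$ denotes its diagonal part ($\delta_{ij}$ is Kronecker's symbol); in particular $\widetilde{X}$ is the diagonal $nk\times nk$ matrix having the same diagonal as $X$. *)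

(* Defs.v *)
From mathcomp Require Import all_boot all_order all_algebra.
From mathcomp Require Import reals complex mxtens.

Set Implicit Arguments.
Unset Strict Implicit.
Unset Printing Implicit Defensive.

Import Order.TTheory GRing.Theory Num.Theory.

Local Open Scope ring_scope.

Definition adjmx (C : numClosedFieldType) (m n : nat) (A : 'M[C]_(m, n)) :
  'M[C]_(n, m) := map_mx Num.conj A^T.

(* In a [numClosedFieldType], [0 <= z] says that [z] is real and nonnegative. *)
Definition psdmx (C : numClosedFieldType) (n : nat) (X : 'M[C]_n) : Prop :=
  adjmx X = X /\
  forall v : 'cV[C]_n, 0 <= (adjmx v *m X *m v) ord0 ord0.

Definition diag_part (C : pzRingType) (n : nat) (u : 'M[C]_n) : 'M[C]_n :=
  \matrix_(i, j) (u i j * (i == j)%:R).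

(* Main.v *)
Require Import Defs.
From mathcomp Require Import all_boot all_order all_algebra.
From mathcomp Require Import reals complex mxtens.

Set Implicit Arguments.
Unset Strict Implicit.
Unset Printing Implicit Defensive.

Import Order.TTheory GRing.Theory Num.Theory.

Local Open Scope ring_scope.

(** Pairing a matrix [u] with [diag_part X] under the trace sees only the
    diagonals of [u] and [X] ([mxtrace_mul_diag_part]).  As the [A nu] are
    diagonal, there are two opposite cases for [u = A nu *t delta_mx m l].
    - If [l = m], then [u] is itself diagonal ([tensmx_is_diag]), so its trace
      against [X] already sees only the diagonal of [X]
      ([mxtrace_diag_mul_diag_part]): the equation is unchanged.
    - If [l != m], then [u] has zero diagonal, so the new left-hand side is [0],
      and so is the right-hand side [B nu l m], because [B nu] is diagonal. *)

Lemma mxtrace_mul_diag_part (C : pzRingType) (n : nat) (u X : 'M[C]_n) :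
  \tr (u *m diag_part X) = \sum_i u i i * X i i.
Proof.
apply: eq_bigr => i _; rewrite mxE (bigD1 i) //= big1 => [|j /negbTE ne_ji].
  by rewrite mxE eqxx mulr1 addr0.
by rewrite mxE ne_ji !mulr0.
Qed.

Lemma mxtrace_diag_mul_diag_part (C : pzRingType) (n : nat) (u X : 'M[C]_n) :
  is_diag_mx u -> \tr (u *m diag_part X) = \tr (u *m X).
Proof.
move=> /is_diag_mxP u_diag; rewrite mxtrace_mul_diag_part.
apply: eq_bigr => i _; rewrite mxE (bigD1 i) //= big1 ?addr0 // => j ne_ji.
by rewrite u_diag ?mul0r // eq_sym.
Qed.

(** A Kronecker index is determined by its two coordinates, so two distinct
    indices differ in at least one of them, and the corresponding factor of the
    entry vanishes. *)
Lemma tensmx_is_diag (C : pzRingType) (n k : nat) (u : 'M[C]_n) (v : 'M[C]_k) :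
  is_diag_mx u -> is_diag_mx v -> is_diag_mx (u *t v).
Proof.
move=> /is_diag_mxP u_diag /is_diag_mxP v_diag; apply/is_diag_mxP => i j.
case: (mxtens_indexP i) => i1 i2; case: (mxtens_indexP j) => j1 j2 ne_ij.
rewrite tensmxE; have [eq1|ne1] := eqVneq i1 j1; last by rewrite u_diag ?mul0r.
rewrite v_diag ?mulr0 //; apply: contraNneq ne_ij => eq2.
by rewrite eq1 (val_inj eq2).
Qed.

Theorem proposition2p6 (R : realType) (n k N : nat)
  (hn : (1 <= n)%N) (hk : (1 <= k)%N) (hN : (1 <= N)%N)
  (A : 'I_N -> 'M[R[i]]_n) (B : 'I_N -> 'M[R[i]]_k)
  (hA : forall nu, is_diag_mx (A nu)) (hB : forall nu, is_diag_mx (B nu))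
  (X : 'M[R[i]]_(n * k)) (hX : psdmx X)
  (hsol : forall (nu : 'I_N) (l m : 'I_k),
     \tr ((A nu *t delta_mx m l) *m X) = B nu l m) :
  forall (nu : 'I_N) (l m : 'I_k),
    \tr ((A nu *t delta_mx m l) *m diag_part X) = B nu l m.
Proof.
move=> nu l m; have [->|ne_lm] := eqVneq l m.
  rewrite mxtrace_diag_mul_diag_part ?hsol //; apply: tensmx_is_diag => //.
  apply/is_diag_mxP => i j ne_ij; rewrite mxE.
  by case: eqP => //= eq_im; case: eqP => // eq_jm; rewrite eq_im eq_jm eqxx in ne_ij.
have /is_diag_mxP -> // := hB nu.
rewrite mxtrace_mul_diag_part big1 // => i _.
case: (mxtens_indexP i) => i1 i2; rewrite tensmxE [delta_mx _ _ _ _]mxE.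
have [->|] := eqVneq i2 m; last by rewrite mulr0 mul0r.
by rewrite eq_sym (negbTE ne_lm) mulr0 mul0r.
Qed.
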